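(* Let $F$ be a finite field with $q$ elements and $\mathrm{char}(F)\neq 2$. Let $X$ be an indeterminate over $F$, $D_n=F[X^{\frac{1}{2^n}},X^{-\frac{1}{2^n}}]$ for each $n\in\mathbb{N}_0$ and $D=\bigcup_{n\in\mathbb{N}_0}D_n$. Suppose that $f(X)\in F[X]$ is a monic polynomial of degree $m$ and $f(0)\neq 0$. Then $f(X)$ is a prime element of $D$ if and only if the following two conditions are satisfied: (1) $4\mid q^m-1$. (2) There exists $n\in\mathbb{N}$ such that (a) $m=\min\{i\in\mathbb{N}\mid n \text{ divides } q^i-1\}$, (b) $2n\nmid q^m-1$, and (c) $f(X)$ is an irreducible factor of $\Phi_n(X)$ over $F$. In this case, $n$ is the order of $f(X)$, $4\mid n$ and $\gcd(q,n)=1$. Moreover, if $\mathrm{char}(F)\equiv 3\pmod 4$, then $m$ is even.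
   Context: $\mathbb{N}$ is the set of positive integers and $\mathbb{N}_0=\mathbb{N}\cup\{0\}$. The elements $X^{1/2^n}$ are compatible roots of $X$, i.e. $(X^{1/2^{n+1}})^2=X^{1/2^n}$, so $D_n\subsetneq D_{n+1}$. $\Phi_n(X)\in\mathbb{Z}[X]$ is the $n$-th cyclotomic polynomial, regarded as a polynomial over $F$. The order of a monic polynomial $f(X)\in F[X]$ with $f(0)\neq 0$ is the smallest $n\in\mathbb{N}$ such that $f(X)\mid X^n-1$.
   Formalization: The last clause is proved under q ≡ 3 (mod 4) instead of char(F) ≡ 3 (mod 4); as stated it is false: for F with 9 elements and f = X − a with a of order 8, f is prime in D (n = 8) but m = 1 is odd. *)

(* Defs.v *)
From HB Require Import structures.
From mathcomp Require Import all_boot all_order all_algebra all_field.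

Set Implicit Arguments.
Unset Strict Implicit.
Unset Printing Implicit Defensive.

Import GRing.Theory.
Local Open Scope ring_scope.

Section PrimeElements.
Variables (K : fieldType) (S : K -> Prop).

Definition dvd_in (a b : K) : Prop := exists2 c, S c & b = a * c.

(* S is meant to be (the carrier of) a subring of K, so a nonzero p in S is a
   unit of S exactly when it divides 1 in S *)
Definition prime_in (p : K) : Prop :=
  [/\ S p, p <> 0, ~ dvd_in p 1 &
      forall a b, S a -> S b ->
        dvd_in p (a * b) -> dvd_in p a \/ dvd_in p b].

End PrimeElements.

Section DyadicLaurent.
Variables (F : fieldType) (K : fieldType) (iota : {rmorphism F -> K}).

(* The roots X^(1/2^n) live in an arbitrary field extension iota : F -> K, and
   x n stands for X^(1/2^n); X = x 0 is an indeterminate over F in that it is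
   transcendental over F. *)
Definition dyadic_roots (x : nat -> K) : Prop :=
  ~ algebraicOver iota (x 0%N) /\ forall n, x n.+1 ^+ 2 = x n.

Definition eval_at (p : {poly F}) (z : K) : K := (map_poly iota p).[z].

(* F[z, z^-1] as a subset of K: a Laurent polynomial in z is a polynomial in z
   divided by a power of z *)
Definition laurent (z y : K) : Prop :=
  exists (p : {poly F}) (k : nat), y = eval_at p z / z ^+ k.

Definition dyadic_laurent (x : nat -> K) (y : K) : Prop :=
  exists n : nat, laurent (x n) y.

End DyadicLaurent.

(* m = min {i >= 1 | P i}; in particular that set is nonempty *)
Definition is_min_pos (P : nat -> bool) (m : nat) : Prop :=
  [/\ (0 < m)%N, P m & forall i, (0 < i)%N -> P i -> (m <= i)%N].

Definition is_poly_order (F : fieldType) (f : {poly F}) (n : nat) : Prop :=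
  is_min_pos (fun k => f %| 'X^k - 1) n.

Definition Phi_over (F : fieldType) (n : nat) : {poly F} :=
  map_poly intr 'Phi_n.

Definition prime_cond (F : fieldType) (q m : nat) (f : {poly F}) (n : nat) :
    Prop :=
  [/\ (0 < n)%N,
      is_min_pos (fun i => n %| q ^ i - 1)%N m,
      ~~ (2 * n %| q ^ m - 1)%N &
      irreducible_poly f /\ f %| Phi_over F n].

(* Main.v *)
(* Since X = (X^(1/2^n))^(2^n) and f(0) <> 0, f(X) is prime in D iff
   f(X^(2^n)) is irreducible over F for every n.  Let e be the order of f, i.e.
   the multiplicative order of its roots; if f is irreducible, its degree m is
   the order of q modulo e.  An irreducible polynomial whose roots have order
   dividing q^i - 1 has degree at most i, so
   - if 2e | q^m - 1, then f(X^2) is reducible;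
   - if 4 does not divide q^m - 1, then 4 | q^m + 1, so 4e | q^(2m) - 1 and
     f(X^4) is reducible.
   Conversely, if neither happens, then e is even and a root of an irreducible
   factor h of f(X^(2^k)) has order 2^k e; this divides q^d - 1 with d = deg h,
   and lifting the exponent at 2 (q^m = 1 mod 4 and e has the same 2-adic
   valuation as q^m - 1) gives 2^k m | d, so h is all of f(X^(2^k)). *)
Require Import Defs.
From mathcomp Require Import all_boot all_order all_algebra all_field.

Set Implicit Arguments.
Unset Strict Implicit.
Unset Printing Implicit Defensive.

Import GRing.Theory.
Local Open Scope ring_scope.

(** * Elementary arithmetic: 2-adic valuations and orders modulo n *)

Lemma odd_sum_ord (n : nat) (E : 'I_n -> nat) :
  (forall i, odd (E i)) -> odd (\sum_(i < n) E i)%N = odd n.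
Proof.
elim: n E => [|n IHn] E oddE; first by rewrite big_ord0.
by rewrite big_ord_recr oddD IHn //= oddE addbT.
Qed.

Lemma dvdn_exp_sub1 (a i : nat) : (a - 1 %| a ^ i - 1)%N.
Proof. by rewrite -{2}(exp1n i) subn_exp dvdn_mulr. Qed.

Lemma eqn_mod4_1 (a : nat) : (0 < a)%N -> (4 %| a - 1)%N = (a == 1 %[mod 4])%N.
Proof. by move=> a_gt0; rewrite eqn_mod_dvd. Qed.

Lemma logn2_add1 (a : nat) : (a = 1 %[mod 4])%N -> logn 2 (a + 1) = 1%N.
Proof.
move=> a1; have -> : (a + 1 = 2 * (a %/ 4 * 2 + 1))%N.
  by rewrite {1}(divn_eq a 4) a1 -addnA mulnDr mulnCA.
rewrite lognM ?addn1 // logn_prime // lognE dvdn2 /= oddM andbF.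
by [].
Qed.

(** Lifting the exponent at 2. Write [j] as 2^e b with b odd: a^b - 1 is a - 1 times a sum of b odd
    terms, and each of the e squarings that follow adds a factor congruent to 2 modulo 4. *)
Lemma logn2_exp_sub1 (a j : nat) :
    (1 < a)%N -> (0 < j)%N -> (4 %| a - 1)%N ->
  logn 2 (a ^ j - 1) = (logn 2 (a - 1) + logn 2 j)%N.
Proof.
move=> a_gt1 j_gt0; have a_gt0 := ltnW a_gt1.
rewrite eqn_mod4_1 // => /eqP a1.
have odd_a: odd a.
  by have /(congr1 odd) := a1; rewrite !odd_mod.
have expa1 i : (a ^ i = 1 %[mod 4])%N by rewrite -modnXm a1 modnXm exp1n.
have exp_sub1_gt0 i : (0 < i)%N -> (0 < a ^ i - 1)%N.
  by move=> i_gt0; rewrite subn_gt0 -(exp1n i) ltn_exp2r.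
have [[|b] odd_b ->] := pfactor_coprime (isT : prime 2) j_gt0.
  by [].
rewrite coprime2n in odd_b; set e := logn 2 j.
have odd_logn c : odd c -> logn 2 c = 0%N.
  by move=> odd_c; rewrite lognE dvdn2 odd_c andbF.
rewrite lognM ?expn_gt0 // (odd_logn b.+1) // add0n pfactorK //.
elim: e => [|e IHe].
  have def_ab : (a ^ b.+1 - 1 = (a - 1) * \sum_(i < b.+1) a ^ (b - i))%N.
    rewrite -[X in (_ - X)%N](exp1n b.+1) subn_exp; congr (_ * _)%N.
    by apply: eq_bigr => i _; rewrite exp1n muln1.
  have odd_sum : odd (\sum_(i < b.+1) a ^ (b - i))%N.
    by rewrite odd_sum_ord // => i; rewrite oddX odd_a orbT.
  rewrite muln1 addn0 def_ab lognM ?subn_gt0 ?odd_gt0 //.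
  by rewrite (odd_logn _ odd_sum) addn0.
rewrite expnSr mulnA expnM -[X in (_ - X)%N](exp1n 2) subn_sqr lognM; last 2 first.
- by rewrite exp_sub1_gt0 // muln_gt0 expn_gt0.
- by rewrite addn1.
by rewrite IHe logn2_add1 // -addnA addn1.
Qed.

(** If n divides q^d - 1, it also divides q^r - 1 for the remainder r of [d] by [m], so r > 0 would
    contradict the minimality of [m]. *)
Lemma is_min_pos_dvdn (q n m d : nat) : (0 < q)%N ->
    is_min_pos (fun i => n %| q ^ i - 1)%N m ->
  (n %| q ^ d - 1)%N -> (m %| d)%N.
Proof.
move=> q_gt0 [m_gt0 n_dvd m_min] n_dvd_d.
have n_dvd_mul : (n %| q ^ (d %/ m * m) - 1)%N.
  by rewrite mulnC expnM (dvdn_trans n_dvd) ?dvdn_exp_sub1.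
rewrite /dvdn; apply/negbNE/negP; rewrite -lt0n => r_gt0.
have: (m <= d %% m)%N; last by rewrite leqNgt ltn_pmod.
apply: m_min => //; rewrite -(dvdn_addr _ (dvdn_mull (q ^ (d %% m)) n_dvd_mul)).
rewrite mulnBr muln1 -expnD [(d %% m + _)%N]addnC -divn_eq.
by rewrite addnBA ?subnK ?expn_gt0 ?q_gt0 ?leq_pexp2l ?leq_mod.
Qed.

(** Meant for [e] the order of some z and [n] the order of z^(2^k). If gcd(e, 2^k) = 2^i, then n
    divides e / 2^i, which is thus even; i < k would make 2^(i+1) a common divisor. *)
Lemma dvdn_exp2_mul (k n e : nat) : (0 < e)%N -> ~~ odd n ->
    (forall N, (e %| 2 ^ k * N)%N -> (n %| N)%N) ->
  (2 ^ k * n %| e)%N.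
Proof.
move=> e_gt0 even_n e_dvd; have := dvdn_gcdl e (2 ^ k).
have /(dvdn_pfactor _ _ (isT : prime 2)) [i le_ik def_g] := dvdn_gcdr e (2 ^ k).
rewrite def_g => /dvdnP [e' def_e].
have n_dvd : (n %| e')%N.
  by apply: e_dvd; rewrite def_e mulnC dvdn_mul ?dvdn_exp2l.
suff -> : k = i by rewrite def_e mulnC dvdn_mul.
apply/eqP; rewrite eqn_leq le_ik andbT leqNgt; apply/negP => lt_ik.
have: (2 ^ i.+1 %| gcdn e (2 ^ k))%N.
  rewrite dvdn_gcd dvdn_exp2l // andbT def_e expnS dvdn_mul //.
  by rewrite (dvdn_trans _ n_dvd) // dvdn2.
by rewrite def_g dvdn_Pexp2l // ltnn.
Qed.

Lemma odd_dvdn4_add1 (a : nat) : odd a -> ~~ (4 %| a - 1)%N -> (4 %| a + 1)%N.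
Proof.
move=> odd_a; rewrite -(odd_double_half a) odd_a addKn addnC addnA -mul2n.
rewrite -[(1 + 1)%N]/(2 * 1)%N -mulnDr -[4%N]/(2 * 2)%N !dvdn_pmul2l //.
by rewrite !dvdn2 oddD negbK => ->.
Qed.

(** Condition (b) in usable form: [n] carries the whole 2-part of [N]. *)
Lemma odd_dvdn_cofactor (n N : nat) :
  (n %| N)%N -> ~~ (2 * n %| N)%N -> exists2 t, odd t & N = (n * t)%N.
Proof.
move=> /dvdnP[t ->] n2_ndvd; exists t; last by rewrite mulnC.
by apply: contraR n2_ndvd; rewrite -dvdn2 => t_even; rewrite dvdn_mul.
Qed.

Lemma dvdn4_of_odd_cofactor (n N : nat) :
  (n %| N)%N -> ~~ (2 * n %| N)%N -> (4 %| N)%N -> (4 %| n)%N.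
Proof.
move=> n_dvd n2_ndvd.
have [t odd_t ->] := odd_dvdn_cofactor n_dvd n2_ndvd.
by rewrite Gauss_dvdl // (coprimeXl 2 (_ : coprime 2 t)) ?coprime2n.
Qed.

Lemma coprime_exp_sub1 (a i : nat) :
  (0 < i)%N -> (0 < a)%N -> coprime a (a ^ i - 1).
Proof.
move=> i_gt0 a_gt0; rewrite -(coprime_pexpl _ _ i_gt0) coprime_sym.
by rewrite -{2}(subnK (_ : 0 < a ^ i)%N) ?expn_gt0 ?a_gt0 // addn1 coprimenS.
Qed.

(** * Roots, orders and degrees of irreducible polynomials over finite fields *)

(** Coprimality survives extension of scalars, so an irreducible [g] not dividing [p] shares no root
    with it. *)
Lemma irredp_dvdp_root (F L : fieldType) (j : {rmorphism F -> L})
    (g p : {poly F}) (z : L) :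
    irreducible_poly g -> root (map_poly j g) z ->
  (g %| p) = root (map_poly j p) z.
Proof.
move=> irr_g gz; apply/idP/idP => [g_dvd | pz].
  by apply: root_dvdp gz; rewrite dvdp_map.
apply/negbNE; rewrite -irreducible_poly_coprime //; apply/negP => cop_gp.
have: coprimep (map_poly j g) (map_poly j p) by rewrite coprimep_map.
by move/coprimep_root => /(_ z gz); rewrite -rootE pz.
Qed.

Lemma irredp_factor (F : finFieldType) (p : {poly F}) :
  (1 < size p)%N -> exists2 g, irreducible_poly g & g %| p.
Proof.
have [n] := ubnP (size p); elim: n p => // n IHn p lt_pn p_gt1.
have [/irreducibleP irr_p | ] := boolP (irreducibleb p).
  by exists p.
rewrite /irreducibleb p_gt1 /= => /forallPn [g].
rewrite negb_imply -ltnNge -Pdiv.Idomain.dvdpE => /andP[g_dvd g_gt1].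
have lt_gp : (size (g : {poly F}) < size p)%N.
  by rewrite (leq_ltn_trans (size_npoly g)) // ltn_predL ltnW.
have [h irr_h h_dvd] := IHn g (leq_trans lt_gp lt_pn) g_gt1.
by exists h => //; apply: dvdp_trans g_dvd.
Qed.

(** [L] is F[X]/(g). The last clause, that z generates [L], serves to extend identities from F and z
    to all of [L]. *)
Lemma irredp_finite_root (F : finFieldType) (g : {poly F}) :
    irreducible_poly g ->
  exists (L : finFieldType) (j : {rmorphism F -> L}) (z : L),
    [/\ root (map_poly j g) z, #|L| = (#|F| ^ (size g).-1)%N &
        forall y, exists p, y = (map_poly j p).[z]].
Proof.
move=> irr_g; have [L dimL [z gz genL]] := irredp_FAdjoin irr_g.
exists (finvect_type L), (GRing.in_alg L), z; split=> // [|y].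
  by rewrite -dimL -(card_vspace (fullv : {vspace finvect_type L})) card_vspacef.
have /Fadjoin_polyP [p p1 ->] : y \in <<1; z>>%VS by rewrite genL memvf.
have /polyOver1P [p' ->] := p1.
by exists p'.
Qed.

Lemma pchar_nat_card (F : finFieldType) : [pchar F].-nat #|F|.
Proof.
have [p p_pr pcharFp] := finPcharP F.
by rewrite (card_pprimeChar pcharFp) pnatX (eq_pnat _ (pcharf_eq pcharFp)) pnat_id.
Qed.

Lemma root_map_Xn_sub1 (F L : fieldType) (j : {rmorphism F -> L})
    (N : nat) (z : L) :
  root (map_poly j ('X^N - 1)) z = (z ^+ N == 1).
Proof. by rewrite rmorphB /= map_polyXn rmorph1 rootE !hornerE subr_eq0. Qed.

(** [e] is the multiplicative order of a root z in F[X]/(g), which is nonzero because g(0) is. *)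
Lemma irredp_order (F : finFieldType) (g : {poly F}) :
    irreducible_poly g -> g.[0] != 0 ->
  exists e, [/\ (0 < e)%N, (e %| #|F| ^ (size g).-1 - 1)%N &
                forall N, (g %| 'X^N - 1) = (e %| N)%N].
Proof.
move=> irr_g g0; have [L [j [z [gz cardL _]]]] := irredp_finite_root irr_g.
have z_neq0 : z != 0.
  apply: contraTneq gz => ->.
  by rewrite -(rmorph0 j) fmorph_root.
have card_gt1 := finRing_gt1 L.
have z_card1 : z ^+ (#|L| - 1) = 1.
  apply: (mulfI z_neq0).
  by rewrite mulr1 -exprS subn1 (ltn_predK card_gt1) expf_card.
have card1_gt0 : (0 < #|L| - 1)%N by rewrite subn_gt0.
have [e prim_z e_dvd] := prim_order_exists card1_gt0 z_card1.
exists e; split; [exact: prim_order_gt0 prim_z | by rewrite -cardL |] => N.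
by rewrite (irredp_dvdp_root _ irr_g gz) root_map_Xn_sub1 -(prim_order_dvd prim_z).
Qed.

(** With N = q^i, the map y -> y^N is a ring endomorphism of F(z) fixing F and z, hence every
    element. So all q^(deg g) elements are roots of X^N - X, which has degree q^i. *)
Lemma irredp_degree_leq (F : finFieldType) (g : {poly F}) (i : nat) :
    irreducible_poly g -> (0 < i)%N -> g %| 'X^(#|F| ^ i - 1) - 1 ->
  ((size g).-1 <= i)%N.
Proof.
move=> irr_g i_gt0; have [L [j [z [gz cardL genL]]]] := irredp_finite_root irr_g.
have card_gt1 := finRing_gt1 F.
set N := (#|F| ^ i)%N.
have N_gt1 : (1 < N)%N by rewrite -(exp1n i) ltn_exp2r.
rewrite (irredp_dvdp_root _ irr_g gz) root_map_Xn_sub1 => /eqP zN1.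
have zN : z ^+ N = z.
  by rewrite -(subnK (ltnW N_gt1)) exprD zN1 mul1r.
(* [N] is a power of the characteristic, which makes y -> y^N additive. *)
have N_nat : [pchar L].-nat N.
  by rewrite pnatX (eq_pnat _ (fmorph_pchar j)) pchar_nat_card.
have cN (c : F) : c ^+ N = c.
  rewrite /N; elim: (i) => [|k IHk]; first by rewrite expr1.
  by rewrite expnSr exprM IHk expf_card.
have LN (y : L) : y ^+ N = y.
  have [p ->] := genL y; elim/poly_ind: p => [|p c IHp].
    by rewrite rmorph0 horner0 expr0n gtn_eqF // ltnW.
  rewrite rmorphD rmorphM /= map_polyX map_polyC !hornerE exprDn_pchar //.
  by rewrite exprMn IHp zN -rmorphXn cN.
have : (size (enum L) < size ('X^N - 'X : {poly L})%R)%N.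
  apply: max_poly_roots; last exact: enum_uniq.
    by rewrite -size_poly_gt0 size_polyDl ?size_polyN ?size_polyX size_polyXn.
  by apply/allP => y _; rewrite rootE !hornerE LN subrr.
rewrite -cardE size_polyDl ?size_polyN ?size_polyX size_polyXn // ltnS cardL.
by rewrite leq_exp2l.
Qed.

(** If z is a root of [h], then z^c is a root of [f], and both sides say that z^(cN) = 1. *)
Lemma irredp_dvdp_comp_Xn (F : finFieldType) (f h : {poly F}) (c N : nat) :
    irreducible_poly f -> irreducible_poly h -> h %| f \Po 'X^c ->
  (h %| 'X^(c * N) - 1) = (f %| 'X^N - 1).
Proof.
move=> irr_f irr_h; have [L [j [z [hz _ _]]]] := irredp_finite_root irr_h.
rewrite !(irredp_dvdp_root _ irr_h hz) map_comp_poly map_polyXn => fz.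
have {}fz : root (map_poly j f) (z ^+ c).
  by move: fz; rewrite rootE horner_comp hornerXn.
by rewrite (irredp_dvdp_root _ irr_f fz) !root_map_Xn_sub1 exprM.
Qed.

(** * Irreducible factors of cyclotomic polynomials over F *)

Lemma irredp_dvdp_prod (F : fieldType) (f : {poly F}) (I : eqType) (s : seq I)
    (E : I -> {poly F}) :
    irreducible_poly f -> f %| \prod_(i <- s) E i ->
  exists2 i, i \in s & f %| E i.
Proof.
move=> irr_f; elim: s => [|i s IHs].
  by rewrite big_nil dvdp1; case: irr_f => /gtn_eqF ->.
rewrite big_cons; have [f_dvd _ | ] := boolP (f %| E i).
  by exists i; rewrite ?mem_head.
rewrite -irreducible_poly_coprime // => /Gauss_dvdpr -> /IHs [k s_k f_dvd].
by exists k; rewrite // in_cons s_k orbT.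
Qed.

Lemma prod_Phi_over (F : fieldType) (n : nat) : (0 < n)%N ->
  \prod_(d <- divisors n) Phi_over F d = 'X^n - 1.
Proof.
move=> n_gt0; rewrite -(rmorph_prod (map_poly intr)) prod_Cyclotomic //.
by rewrite rmorphB /= map_polyXn rmorph1.
Qed.

Lemma Phi_over_dvdp (F : fieldType) (n : nat) : (0 < n)%N ->
  Phi_over F n %| 'X^n - 1.
Proof.
move=> n_gt0; rewrite -prod_Phi_over // (big_rem n) ?dvdp_mulr //=.
by rewrite divisors_id.
Qed.

(** Since X^e - 1 is the product of the Phi_d with d | e, [f] divides one of these. If it also
    divides Phi_n with n different from d, then f^2 divides X^n - 1, which is separable as n is
    nonzero in F. *)
Lemma irredp_dvdp_Phi (F : fieldType) (f : {poly F}) (e n : nat) :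
    irreducible_poly f -> (0 < n)%N -> n%:R != 0 :> F ->
    (forall N, (f %| 'X^N - 1) = (e %| N)%N) ->
  (f %| Phi_over F n) = (e == n).
Proof.
move=> irr_f n_gt0 nF f_order.
have Phi_order d : (0 < d)%N -> f %| Phi_over F d -> (e %| d)%N.
  by move=> d_gt0 f_dvd; rewrite -f_order (dvdp_trans f_dvd) ?Phi_over_dvdp.
have dvd_Phi k : (0 < k)%N -> (e %| k)%N ->
    exists2 d, (d %| k)%N & f %| Phi_over F d.
  move=> k_gt0; rewrite -f_order -(prod_Phi_over F) // => /(irredp_dvdp_prod irr_f) [d].
  by rewrite -dvdn_divisors //; exists d.
apply/idP/eqP => [f_dvd | e_n]; last first.
  (* [f] divides Phi_d for some d | n; its order e = n then divides d. *)
  have [|d d_dvd f_dvd] := dvd_Phi n n_gt0; first by rewrite e_n.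
  suff <- : d = n by [].
  by apply/eqP; rewrite eqn_dvd d_dvd -{1}e_n Phi_order ?(dvdn_gt0 n_gt0).
have e_dvd := Phi_order n n_gt0 f_dvd.
have e_gt0 := dvdn_gt0 n_gt0 e_dvd.
have [d d_dvd f_dvd_d] := dvd_Phi e e_gt0 (dvdnn e).
have [d_n | d_n] := eqVneq d n.
  by apply/eqP; rewrite eqn_dvd e_dvd -d_n.
have size_f : size f != 1%N by case: irr_f => /gtn_eqF ->.
have sqf := separable_nosquare (separable_Xn_sub_1 nF) (isT : (1 < 2)%N) size_f.
suff: f ^+ 2 %| 'X^n - 1 by rewrite sqf.
have [n_div d_div] : n \in divisors n /\ d \in divisors n.
  by rewrite -!dvdn_divisors // dvdnn (dvdn_trans d_dvd).
rewrite -prod_Phi_over // (big_rem n) //= (big_rem d) /=; last first.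
  by rewrite mem_rem_uniq ?divisors_uniq // inE d_n.
by rewrite mulrA dvdp_mulr // expr2 dvdp_mul.
Qed.

(** * Substitution of X^c for X *)

Lemma size_comp_Xn (F : fieldType) (p : {poly F}) (c : nat) :
  (size (p \Po 'X^c)).-1 = ((size p).-1 * c)%N.
Proof. by rewrite size_comp_poly size_polyXn. Qed.

Lemma comp_Xn_eq0 (F : fieldType) (p : {poly F}) (c : nat) :
  (0 < c)%N -> (p \Po 'X^c == 0) = (p == 0).
Proof. by move=> c_gt0; rewrite comp_poly_eq0 // size_polyXn. Qed.

Lemma horner0_comp_Xn (F : fieldType) (p : {poly F}) (c : nat) :
  (0 < c)%N -> (p \Po 'X^c).[0] = p.[0].
Proof. by move=> c_gt0; rewrite horner_comp hornerXn expr0n gtn_eqF. Qed.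

(** Substituting X^c in the Euclidean division of [p] by [g] keeps the remainder of smaller degree
    than the divisor. *)
Lemma dvdp_comp_Xn (F : fieldType) (g p : {poly F}) (c : nat) :
  (0 < c)%N -> (g \Po 'X^c %| p \Po 'X^c) = (g %| p).
Proof.
move=> c_gt0; apply/idP/idP => [|/dvdpP[h ->]]; last first.
  by rewrite comp_polyM dvdp_mull.
have [-> | g_neq0] := eqVneq g 0; first by rewrite comp_poly0 !dvd0p comp_Xn_eq0.
rewrite {1}(divp_eq p g) comp_polyD comp_polyM dvdp_addr ?dvdp_mull //.
apply: contraLR => r_neq0.
have rc_neq0 : (p %% g) \Po 'X^c != 0 by rewrite comp_Xn_eq0.
apply/negP => /(dvdp_leq rc_neq0).
have gc_neq0 : g \Po 'X^c != 0 by rewrite comp_Xn_eq0.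
rewrite -[leqRHS]prednK ?size_poly_gt0 // -[leqLHS]prednK ?size_poly_gt0 //.
rewrite ltnS !size_comp_Xn leq_pmul2r // leqNgt -ltnS !prednK ?size_poly_gt0 //.
by rewrite ltn_modp g_neq0.
Qed.

Lemma dvdp_mulXn (F : fieldType) (g p : {poly F}) (k : nat) :
  g.[0] != 0 -> (g %| p * 'X^k) = (g %| p).
Proof.
by move=> g0; rewrite Gauss_dvdpl // coprimep_expr // coprimepX rootE.
Qed.

(** * Divisibility and primality in D *)

Section DyadicLaurentTheory.
Variables (F K : fieldType) (iota : {rmorphism F -> K}) (x : nat -> K).
Hypothesis x_roots : dyadic_roots iota x.

Local Notation ev := (eval_at iota).
Local Notation D := (dyadic_laurent iota x).

Lemma eval_atM (p r : {poly F}) (z : K) : ev (p * r) z = ev p z * ev r z.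
Proof. by rewrite /eval_at rmorphM hornerM. Qed.

Lemma eval_at_Xn (k : nat) (z : K) : ev 'X^k z = z ^+ k.
Proof. by rewrite /eval_at map_polyXn hornerXn. Qed.

Lemma eval_at_comp_Xn (p : {poly F}) (c : nat) (z : K) :
  ev (p \Po 'X^c) z = ev p (z ^+ c).
Proof. by rewrite /eval_at map_comp_poly map_polyXn horner_comp hornerXn. Qed.

Lemma dyadic_roots_exp (n i : nat) : x (n + i)%N ^+ (2 ^ i) = x n.
Proof.
elim: i => [|i IHi]; first by rewrite addn0.
by rewrite addnS expnS exprM; case: x_roots => _ ->.
Qed.

Lemma eval_at_dyadic_lift (p : {poly F}) (n i : nat) :
  ev p (x n) = ev (p \Po 'X^(2 ^ i)) (x (n + i)%N).
Proof. by rewrite eval_at_comp_Xn dyadic_roots_exp. Qed.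

(** Every [x n] is transcendental, because its power [x 0] is. *)
Lemma eval_at_dyadic_eq0 (p : {poly F}) (n : nat) : (ev p (x n) == 0) = (p == 0).
Proof.
apply/idP/eqP => [pz | ->]; last by rewrite /eval_at rmorph0 horner0.
apply/eqP; apply: contra_notT (proj1 x_roots) => p_neq0.
have xn_alg : algebraicOver iota (x n) by exists p; rewrite ?rootE.
rewrite -(dyadic_roots_exp 0 n); elim: (2 ^ n)%N => [|k IHk].
  exact: algebraic1.
by rewrite exprS; apply: algebraic_mul.
Qed.

Lemma eval_at_dyadic_inj (n : nat) : injective (ev ^~ (x n)).
Proof.
move=> p r /eqP; rewrite -subr_eq0 -hornerN -hornerD -rmorphN -rmorphD.
by rewrite -[_ == 0]/(ev _ _ == 0) eval_at_dyadic_eq0 subr_eq0 => /eqP.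
Qed.

Lemma dyadic_root_neq0 (n : nat) : x n != 0.
Proof.
have := eval_at_dyadic_eq0 'X n; rewrite polyX_eq0 => /negbT.
by rewrite -['X]expr1 eval_at_Xn.
Qed.

Lemma laurent_lift (n i : nat) (y : K) :
  laurent iota (x n) y -> laurent iota (x (n + i)%N) y.
Proof.
case=> p [k ->]; exists (p \Po 'X^(2 ^ i)), (2 ^ i * k)%N.
by rewrite -eval_at_dyadic_lift exprM dyadic_roots_exp.
Qed.

(** A quotient in D lies at some level [l]. Lifting to level n + l and clearing its denominator
    gives g(X^(2^l)) | p(X^(2^l)) X^k; X^k cancels as g(0) is nonzero, and the substitution is
    undone. *)
Lemma dvd_in_eval_at (n : nat) (g p : {poly F}) : g.[0] != 0 ->
  dvd_in D (ev g (x n)) (ev p (x n)) <-> g %| p.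
Proof.
move=> g0; split=> [[c [l c_l] def_p] | /dvdpP[h ->]]; last first.
  exists (ev h (x n)); last by rewrite eval_atM mulrC.
  by exists n, h, 0%N; rewrite divr1.
have := laurent_lift n c_l; rewrite addnC => -[h [k def_c]].
have e_gt0 : (0 < 2 ^ l)%N by rewrite expn_gt0.
rewrite -(dvdp_comp_Xn g p e_gt0) -(dvdp_mulXn _ k) ?horner0_comp_Xn //.
apply/dvdpP; exists h; apply: (@eval_at_dyadic_inj (n + l)).
rewrite !eval_atM eval_at_Xn -!eval_at_dyadic_lift def_p def_c mulrA.
by rewrite mulfVK ?expf_neq0 ?dyadic_root_neq0 // mulrC.
Qed.

Lemma dvd_in_laurent (n : nat) (g p : {poly F}) (k : nat) : g.[0] != 0 ->
  dvd_in D (ev g (x n)) (ev p (x n) / x n ^+ k) <-> g %| p.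
Proof.
move=> g0; have xk_neq0 : x n ^+ k != 0 by rewrite expf_neq0 ?dyadic_root_neq0.
split=> [[c [l c_l] def_p] | /dvdpP[h ->]]; last first.
  exists (ev h (x n) / x n ^+ k); first by exists n, h, k.
  by rewrite eval_atM mulrA [ev g _ * _]mulrC.
(* The power of [x n] is a unit of D and moves into the quotient. *)
apply/(dvd_in_eval_at n) => //; exists (c * x n ^+ k); last first.
  by rewrite mulrA -def_p divfK.
have [h [i def_c]] := laurent_lift n c_l.
exists (l + n)%N, (h * 'X^(2 ^ l * k)), i.
by rewrite def_c eval_atM eval_at_Xn exprM [(l + n)%N]addnC dyadic_roots_exp mulrAC.
Qed.

(** A factorization of f(X^(2^n)) is one of f(X) in D, where primality forces a trivial factor.
    Conversely, two elements of D have a common level n, where an irreducible f(X^(2^n)) dividing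
    the product of numerators divides one of them. *)
Lemma prime_in_dyadicP (f : {poly F}) : f.[0] != 0 ->
  prime_in D (ev f (x 0%N)) <->
  forall n, irreducible_poly (f \Po 'X^(2 ^ n)).
Proof.
move=> f0; have e_gt0 n : (0 < 2 ^ n)%N by rewrite expn_gt0.
have lift_f n : ev f (x 0%N) = ev (f \Po 'X^(2 ^ n)) (x n).
  exact: eval_at_dyadic_lift.
have fn0 n : (f \Po 'X^(2 ^ n)).[0] != 0 by rewrite horner0_comp_Xn.
have D1 : 1 = ev 1 (x 0%N) by rewrite /eval_at rmorph1 hornerC.
have f_neq0 : f != 0 by apply: contraNneq f0 => ->; rewrite horner0.
split=> [[_ _ f_nunit f_prime] n | irr_f].
  have size_f : (1 < size f)%N.
    (* A nonzero constant would be a unit of D. *)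
    rewrite ltnNge; apply/negP => /size1_polyC def_f; apply: f_nunit.
    rewrite D1; apply/dvd_in_eval_at => //; rewrite def_f in f_neq0 *.
    by rewrite polyC_eq0 in f_neq0; rewrite dvdp1 size_polyC f_neq0.
  set g := f \Po 'X^(2 ^ n).
  have g_neq0 : g != 0 by rewrite comp_Xn_eq0.
  have size_g : (1 < size g)%N.
    rewrite -[size g]prednK ?size_poly_gt0 // ltnS size_comp_Xn muln_gt0 e_gt0.
    by rewrite andbT -ltnS prednK // ltnW.
  split=> // h h_neq1 h_dvd; have /dvdpP[h' def_g] := h_dvd.
  have h'_neq0 : h' != 0.
    by apply: contraNneq g_neq0 => h'0; rewrite def_g h'0 mul0r.
  have h_neq0 : h != 0 by apply: contraNneq g_neq0 => h0; rewrite def_g h0 mulr0.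
  have D_ev p : D (ev p (x n)) by exists n, p, 0%N; rewrite divr1.
  have := f_prime _ _ (D_ev h') (D_ev h).
  rewrite -eval_atM -def_g (lift_f n) => -[].
  - by exists 1; rewrite ?mulr1 //; exists 0%N, 1, 0%N; rewrite -D1 divr1.
  (* As [h] is not constant, [h'] has smaller degree than [g], so [g] cannot divide it. *)
  - move/(dvd_in_eval_at n _ (fn0 n))/(dvdp_leq h'_neq0).
    rewrite -/g def_g size_mul // leqNgt -ltnS.
    have : (1 < size h)%N by rewrite ltn_neqAle eq_sym h_neq1 size_poly_gt0.
    case: (size h) => [|[|s]] // _.
    by rewrite !addnS /= ltnS leq_addr.
  - by move/(dvd_in_eval_at n _ (fn0 n)) => g_dvd; rewrite /eqp h_dvd.
split.
- by exists 0%N, f, 0%N; rewrite divr1.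
- by apply/eqP; rewrite eval_at_dyadic_eq0.
- rewrite D1 => /(dvd_in_eval_at 0 _ f0); rewrite dvdp1.
  by have [] := irr_f 0%N; rewrite comp_polyXr => /gtn_eqF ->.
move=> a b [n1 a_n1] [n2 b_n2].
have [p [k ->]] := laurent_lift n2 a_n1.
have := laurent_lift n1 b_n2; rewrite addnC; set n := (n1 + n2)%N => -[r [l ->]].
rewrite mulf_div -eval_atM -exprD (lift_f n) => /(dvd_in_laurent _ _ _ (fn0 n)).
have [g_dvd _ | ] := boolP (f \Po 'X^(2 ^ n) %| p).
  by left; apply/dvd_in_laurent.
rewrite -irreducible_poly_coprime // => /Gauss_dvdpr -> g_dvd.
by right; apply/dvd_in_laurent.
Qed.

End DyadicLaurentTheory.

(** * The arithmetic conditions and irreducibility of f(X^(2^k)) *)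

Lemma pchar2_odd_card (F : finFieldType) : 2%N \notin [pchar F] -> odd #|F|.
Proof.
move=> not2; rewrite -[odd _]negbK -dvdn2; apply: contra not2 => q_even.
have /pnatP -> // := pchar_nat_card F.
by rewrite ltnW ?finRing_gt1.
Qed.

(** The characteristic divides q^i, so it cannot divide q^i - 1, nor [n]. *)
Lemma dvdn_card_exp_sub1_neq0 (F : finFieldType) (n i : nat) :
  (0 < i)%N -> (n %| #|F| ^ i - 1)%N -> n%:R != 0 :> F.
Proof.
move=> i_gt0 n_dvd; have card_gt1 := finRing_gt1 F.
have p_pr := pdiv_prime card_gt1; set p := pdiv _ in p_pr.
have pcharFp : p \in [pchar F].
  by have /pnatP -> // := pchar_nat_card F; rewrite ?pdiv_dvd // ltnW.
rewrite -(dvdn_pcharf pcharFp); apply/negP => /dvdn_trans/(_ n_dvd) p_dvd.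
have p_dvd_qi : (p %| #|F| ^ i)%N by rewrite Euclid_dvdX // i_gt0 pdiv_dvd.
have qi_gt0 : (0 < #|F| ^ i)%N by rewrite expn_gt0 ltnW.
move: p_dvd_qi; rewrite -(subnK qi_gt0) dvdn_addr // dvdn1 => /eqP p1.
by rewrite p1 in p_pr.
Qed.

Section FiniteField.
Variables (F : finFieldType) (f : {poly F}) (m : nat).
Hypotheses (size_f : size f = m.+1) (f0 : f.[0] != 0).
Local Notation q := #|F|.

Let q_gt1 : (1 < q)%N := finRing_gt1 F.

Lemma prime_cond_order (n : nat) : prime_cond q m f n ->
  forall N, (f %| 'X^N - 1) = (n %| N)%N.
Proof.
case=> n_gt0 [m_gt0 n_dvd _] _ [irr_f f_Phi] N.
have [e [_ _ f_order]] := irredp_order irr_f f0.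
move: f_Phi; rewrite (irredp_dvdp_Phi irr_f _ _ f_order) //.
  by move=> /eqP <-.
exact: dvdn_card_exp_sub1_neq0 n_dvd.
Qed.

(** Any nonconstant divisor [r] of [g] has an irreducible factor [h], whose degree [d] is shown to
    be at least m 2^k, the degree of [g]. *)
Lemma prime_cond_irredp_comp (n k : nat) :
    (4 %| q ^ m - 1)%N -> prime_cond q m f n ->
  irreducible_poly (f \Po 'X^(2 ^ k)).
Proof.
move=> Q4 cond_n; have f_order := prime_cond_order cond_n.
have [n_gt0 min_m n2_ndvd [irr_f _]] := cond_n; have [m_gt0 n_dvd _] := min_m.
have Q_gt1 : (1 < q ^ m)%N by rewrite -(exp1n m) ltn_exp2r.
have [t odd_t def_Q] := odd_dvdn_cofactor n_dvd n2_ndvd.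
have t_gt0 := odd_gt0 odd_t.
have n4 : (4 %| n)%N.
  exact: dvdn4_of_odd_cofactor n_dvd n2_ndvd Q4.
have e_gt0 : (0 < 2 ^ k)%N by rewrite expn_gt0.
set g := f \Po 'X^(2 ^ k).
have g_neq0 : g != 0 by rewrite comp_Xn_eq0 // -size_poly_gt0 size_f.
have size_g : (size g).-1 = (m * 2 ^ k)%N by rewrite size_comp_Xn size_f.
split=> [|r r_neq1 r_dvd].
  by rewrite -[size g]prednK ?size_poly_gt0 // ltnS size_g muln_gt0 m_gt0.
have r_neq0 : r != 0 by apply: contraNneq g_neq0 => r0; rewrite r0 dvd0p in r_dvd.
have [|h irr_h h_dvd] := @irredp_factor F r.
  by rewrite ltn_neqAle eq_sym r_neq1 size_poly_gt0.
have h_dvd_g := dvdp_trans h_dvd r_dvd.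
have h0 : h.[0] != 0.
  apply: contraNneq f0 => h0; rewrite -(horner0_comp_Xn f e_gt0) -rootE.
  by apply: root_dvdp h_dvd_g _; rewrite rootE h0.
have [e [h_gt0 h_dvd_card h_order]] := irredp_order irr_h h0.
set d := (size h).-1 in h_dvd_card.
have d_gt0 : (0 < d)%N by case: irr_h; rewrite /d; case: (size h) => [|[]].
(* [e] is the order of the roots of [h], whose 2^k-th powers are roots of [f], of order [n]. *)
have n_dvd_e : (2 ^ k * n %| e)%N.
  apply: dvdn_exp2_mul => // [|N].
    by rewrite -dvdn2 (dvdn_trans _ n4).
  by rewrite -h_order (irredp_dvdp_comp_Xn _ irr_f irr_h h_dvd_g) f_order.
have n_dvd_d := dvdn_trans n_dvd_e h_dvd_card.
have /dvdnP [j def_d] : (m %| d)%N.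
  apply: is_min_pos_dvdn min_m _; first exact: ltnW.
  by rewrite (dvdn_trans _ n_dvd_d) ?dvdn_mull.
have j_gt0 : (0 < j)%N by move: d_gt0; rewrite def_d muln_gt0 => /andP[].
(* Writing v for the 2-adic valuation, v(q^m - 1) + v(j) = v(q^d - 1) is at least k + v(n), and v(n)
   = v(q^m - 1) because [t] is odd. *)
have dvd_kj : (2 ^ k %| j)%N.
  rewrite pfactor_dvdn // -(leq_add2l (logn 2 (q ^ m - 1))) -logn2_exp_sub1 //.
  rewrite -expnM mulnC -def_d def_Q lognM // [logn 2 t]lognE dvdn2 odd_t andbF.
  rewrite addn0.
  have := dvdn_leq_log 2 _ n_dvd_d; rewrite lognM // pfactorK // addnC; apply.
  by rewrite subn_gt0 -(exp1n d) ltn_exp2r.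
rewrite -dvdp_size_eqp // eqn_leq dvdp_leq //=.
rewrite (leq_trans _ (dvdp_leq r_neq0 h_dvd)) //.
have h_neq0 : h != 0 by apply: irredp_neq0.
rewrite -[leqRHS]prednK ?size_poly_gt0 // -[leqLHS]prednK ?size_poly_gt0 //.
by rewrite ltnS size_g -/d def_d mulnC leq_mul2r (dvdn_leq j_gt0) ?orbT.
Qed.

Lemma irredp_comp_prime_cond : odd q ->
    (forall k, irreducible_poly (f \Po 'X^(2 ^ k))) ->
  (4 %| q ^ m - 1)%N /\ exists n, prime_cond q m f n.
Proof.
move=> odd_q irr_fk.
have irr_f : irreducible_poly f by have := irr_fk 0%N; rewrite comp_polyXr.
have m_gt0 : (0 < m)%N by case: irr_f; rewrite size_f.
have [n [n_gt0]] := irredp_order irr_f f0; rewrite size_f /= => n_dvd f_order.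
(* If 2^k n divides q^i - 1, the irreducible f(X^(2^k)) divides X^(q^i - 1) - 1, which bounds its
   degree. The values k = 2, 0, 1 yield (1), the minimality in (a), and (b). *)
have degree_leq k i : (0 < i)%N -> (2 ^ k * n %| q ^ i - 1)%N -> (m * 2 ^ k <= i)%N.
  move=> i_gt0 /dvdnP [t def_qi]; rewrite -[m]/(m.+1.-1) -size_f -size_comp_Xn.
  apply: irredp_degree_leq => //; rewrite def_qi mulnC -mulnA.
  by rewrite (irredp_dvdp_comp_Xn _ irr_f) // f_order dvdn_mulr.
have Q_gt0 : (0 < q ^ m)%N by rewrite expn_gt0 ltnW.
have cond_n : (4 %| q ^ m - 1)%N.
  apply/idPn => nQ4.
  (* Otherwise 4 divides q^m + 1, so 4n divides (q^m - 1)(q^m + 1) = q^(2m) - 1. *)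
  have : (m * 2 ^ 2 <= m * 2)%N; last by rewrite leq_pmul2l.
  apply: degree_leq; first by rewrite muln_gt0 m_gt0.
  rewrite mulnC expnM -[X in (_ - X)%N](exp1n 2) subn_sqr dvdn_mul //.
  by rewrite odd_dvdn4_add1 // oddX odd_q orbT.
split=> //; exists n; split=> //.
- split=> // i i_gt0 n_dvd_i; have := degree_leq 0%N i i_gt0.
  by rewrite mul1n muln1; apply.
- apply/negP => /(degree_leq 1%N m m_gt0).
  by rewrite leqNgt -[X in (X < _)%N]muln1 ltn_pmul2l.
- split=> //; rewrite (irredp_dvdp_Phi irr_f _ _ f_order) //.
  exact: dvdn_card_exp_sub1_neq0 n_dvd.
Qed.

End FiniteField.

(* The last clause has #|F| = 3 mod 4 where the source has char F = 3 mod 4: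
   over F_9 the latter fails, e.g. for f = X - a with a of order 8 (m = 1). *)
Theorem proposition4p10
    (F : finFieldType) (q : nat) (hq : #|F| = q)
    (hchar : 2%N \notin [pchar F])
    (K : fieldType) (iota : {rmorphism F -> K})
    (x : nat -> K) (hx : dyadic_roots iota x)
    (f : {poly F}) (m : nat)
    (hf : f \is monic) (hm : size f = m.+1) (hf0 : f.[0] != 0) :
  let f_prime_in_D := prime_in (dyadic_laurent iota x) (eval_at iota f (x 0%N)) in
  [/\ f_prime_in_D <->
        (4 %| q ^ m - 1)%N /\ (exists n, prime_cond q m f n),
      f_prime_in_D ->
        forall n, prime_cond q m f n ->
          [/\ is_poly_order f n, (4 %| n)%N & gcdn q n = 1%N]
    & f_prime_in_D -> (q = 3 %[mod 4])%N -> ~~ odd m].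
Proof.
subst q; have odd_q := pchar2_odd_card hchar.
have card_gt1 := finRing_gt1 F.
have cond_of_prime :
    prime_in (dyadic_laurent iota x) (eval_at iota f (x 0%N)) ->
    (4 %| #|F| ^ m - 1)%N /\ exists n, prime_cond #|F| m f n.
  by move/(prime_in_dyadicP hx hf0); apply: irredp_comp_prime_cond.
split.
- split=> // -[Q4 [n cond_n]]; apply/(prime_in_dyadicP hx hf0) => k.
  exact: prime_cond_irredp_comp cond_n.
- move=> /cond_of_prime [Q4 _] n cond_n.
  have [n_gt0 [m_gt0 n_dvd _] n2_ndvd _] := cond_n.
  have f_order := prime_cond_order hf0 cond_n.
  have Q_gt1 : (1 < #|F| ^ m)%N by rewrite -(exp1n m) ltn_exp2r.
  split.
  + by split=> [||i i_gt0]; rewrite ?f_order //; apply: dvdn_leq.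
  + exact: dvdn4_of_odd_cofactor n_dvd n2_ndvd Q4.
  + exact/eqP/(coprime_dvdr n_dvd)/coprime_exp_sub1/ltnW.
- move=> /cond_of_prime [Q4 _] q3; apply: contraL Q4 => odd_m.
  (* As 3^2 = 1 modulo 4, an odd [m] would give q^m = 3 modulo 4. *)
  rewrite eqn_mod4_1 ?expn_gt0 1?ltnW // -modnXm q3 modnXm.
  rewrite -(odd_double_half m) odd_m expnS -mul2n expnM -modnMmr -modnXm exp1n.
  by [].
Qed.
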